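(* Let $(E,\mathcal{E})$ be a measurable space endowed with a $\sigma$-finite measure $\mu:\mathcal{E}\to[0,\infty]$, let $p\in[1,\infty)$, and let $(S_t)_{t>0}$ be a family of (not necessarily linear) operators on $L^p(E,\mu)$ such that: (1) (Measurability) for every $f\in L^p(E,\mu)$, the functions $S_tf$ admit representatives for which $(0,\infty)\times E\ni(t,x)\mapsto S_tf(x)$ is jointly measurable with respect to the product $\sigma$-algebra of the Borel $\sigma$-algebra $\mathcal{B}(0,\infty)$ and $\mathcal{E}$; (2) (Boundedness) there exists a constant $C>0$ such that $\|S_tf\|_{L^p(\mu)}\le C\|f\|_{L^p(\mu)}$ for all $t\in(0,1]$ and all $f\in L^p(E,\mu)$; (3) (Continuity) $\lim_{t\to0^+}\|S_tf\|_{L^p(\mu)}=\|f\|_{L^p(\mu)}$ for every $f\in L^p(E,\mu)$. For $\alpha>0$ and $f\in L^p(E,\mu)$ set $$\|f\|_{\mathcal{W}^{-\alpha,p}(\mu)}=\left(\int_0^1t^{\frac{\alpha p}{2}-1}\|S_tf\|_{L^p(\mu)}^p\,dt\right)^{1/p}.$$ Then, for every $f\in L^p(E,\mu)$, $$\lim_{\alpha\to0^+}\alpha\|f\|_{\mathcal{W}^{-\alpha,p}(\mu)}^p=\frac{2}{p}\|f\|_{L^p(\mu)}^p .$$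
   Context: $L^p(E,\mu)$ is the Lebesgue space over $(E,\mathcal{E},\mu)$ with norm $\|f\|_{L^p(\mu)}=\left(\int_E|f(x)|^p\,\mu(dx)\right)^{1/p}$. The operators $S_t$ are maps from $L^p(E,\mu)$ to itself; no linearity, contraction, semigroup, or strong continuity property is assumed. *)

(* Defs.v *)
From HB Require Import structures.
From mathcomp Require Import all_boot all_order all_algebra.
From mathcomp Require Import all_classical all_reals all_analysis.

Set Implicit Arguments.
Unset Strict Implicit.
Unset Printing Implicit Defensive.

Import Order.TTheory GRing.Theory Num.Theory.
Import numFieldNormedType.Exports.
Local Open Scope classical_set_scope.
Local Open Scope ring_scope.

(* L^p(E, mu) is the quotient space LspaceType mu p1.  A family (S_t)_{t > 0}
   of operators is given as a function of a real parameter whose values at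
   t <= 0 are never used; in particular the integral runs over ]0, 1]. *)

Section definitions.
Context d (E : measurableType d) (R : realType).
Variables (mu : {measure set E -> \bar R}) (p : R) (p1 : (1 <= p%:E)%E).

Definition Lpnorm (f : LspaceType mu p1) : \bar R := 'N[mu]_(p%:E)[EFin \o f].

Definition jointly_measurable_family (S : R -> LspaceType mu p1 -> LspaceType mu p1) :=
  forall f : LspaceType mu p1, exists u : measurableTypeR R * E -> measurableTypeR R,
    measurable_fun ((`]0%R, +oo[ : set (measurableTypeR R)) `*` [set: E]) u /\
    forall t : R, 0 < t -> (fun x => u (t, x)) = S t f %[ae mu].

Definition neg_sobolev_norm (S : R -> LspaceType mu p1 -> LspaceType mu p1)
    (alpha : R) (f : LspaceType mu p1) : \bar R :=
  ((\int[@lebesgue_measure R]_(t in `]0%R, 1%R])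
      ((t `^ (alpha * p / 2 - 1))%:E * Lpnorm (S t f) `^ p)) `^ p^-1)%E.

End definitions.

(* Main.v *)
(* With a = alpha p / 2, alpha times the p-th power of the Sobolev norm is 2 / p
   times the average of h t = ||S_t f||^p against the probability density
   a t^(a - 1) on ]0, 1].  On [r, 1] this density is at most a / r, so as a tends
   to 0 the mass concentrates at 0 and the average of the bounded function h
   tends to the limit of h at 0. *)
Require Import Defs.
From HB Require Import structures.
From mathcomp Require Import all_boot all_order all_algebra.
From mathcomp Require Import all_classical all_reals all_analysis.
From mathcomp Require Import measurable_realfun.

Import Order.TTheory GRing.Theory Num.Theory.
Import numFieldNormedType.Exports.
Local Open Scope classical_set_scope.
Local Open Scope ring_scope.

(** * Integral of a power over []0, 1]] *)

Lemma powR_continuous_gt0 {R : realType} (r x : R) : 0 < x ->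
  {for x, continuous (fun t : R => t `^ r)}.
Proof.
move=> x0; apply: differentiable_continuous; apply/derivable1_diffP.
by apply: derivable_powR; rewrite in_itv/= x0.
Qed.

Lemma itv_oc01_bigcup {R : realType} :
  `]0, 1]%classic = \bigcup_n `[n.+1%:R^-1, (1 : R)]%classic.
Proof.
apply/seteqP; split => x /=.
- rewrite in_itv/= => /andP[x0 x1]; exists (Num.truncn x^-1) => //=.
  rewrite in_itv/= x1 andbT invf_ple ?posrE//.
  by apply/ltW/truncnS_gt.
- move=> [n _ /=]; rewrite !in_itv/= => /andP[nx ->]; rewrite andbT.
  by rewrite (lt_le_trans _ nx)// invr_gt0.
Qed.

(** For [a < 1] the integrand blows up at 0, so the fundamental theorem of calculus is applied on
    [[1/(n+1), 1]], and monotone convergence passes to the union of these intervals. *)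
Lemma integral_powR_oc01 {R : realType} (a : R) : 0 < a ->
  (\int[@lebesgue_measure R]_(t in `]0%R, 1%R]) (t `^ (a - 1))%:E = (a^-1)%:E)%E.
Proof.
move=> a0.
pose F n := `[n.+1%:R^-1, (1 : R)]%classic.
have mw (D : set R) : measurable_fun D (fun t : R => (t `^ (a - 1))%:E).
  by apply/measurable_EFinP; exact: measurable_funTS (measurable_powR _).
have cvgF : (\int[@lebesgue_measure R]_(t in F n) (t `^ (a - 1))%:E)%E
    @[n --> \oo] --> (\int[@lebesgue_measure R]_(t in \bigcup_n F n)
      (t `^ (a - 1))%:E)%E.
  apply: ge0_nondecreasing_set_cvg_integral => //.
  - move=> m n mn; apply/subsetPset => x; rewrite /F /= !in_itv/= => /andP[mx ->].
    by rewrite andbT (le_trans _ mx)// lef_pV2 ?posrE// ler_nat ltnS.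
  - by move=> n; exact: measurable_itv.
  - by move=> n; exact: mw.
  - by move=> n x _; rewrite lee_fin powR_ge0.
rewrite itv_oc01_bigcup; apply/esym.
apply: (cvg_unique _ _ cvgF) => //.
have FE n : (\int[@lebesgue_measure R]_(t in F n) (t `^ (a - 1))%:E =
    (a^-1 - (a^-1 * n.+1%:R^-1 `^ a))%:E)%E.
  have n0 : 0 < n.+1%:R^-1 :> R by rewrite invr_gt0.
  (* For [n = 0] the interval degenerates to the point 1, while the fundamental theorem needs
     distinct endpoints; both sides are then 0. *)
  rewrite /F; have [->|nN0] := eqVneq n 0%N.
    by rewrite invr1 powR1 mulr1 subrr set_itv1 integral_set1.
  have n1 : n.+1%:R^-1 < 1 :> R by rewrite invf_lt1// ltr1n ltnS lt0n.
  have dF (x : R) : 0 < x -> is_derive x 1 (fun t : R => a^-1 * t `^ a) (x `^ (a - 1)).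
    move=> x0.
    rewrite -[X in is_derive _ _ _ X](@mulKf _ a) ?gt_eqF//.
    exact: (is_deriveZ (a^-1) (is_derive1_powR a x0)).
  have cF (x : R) : 0 < x -> {for x, continuous (fun t : R => a^-1 * t `^ a)}.
    by move=> x0; apply: differentiable_continuous; apply/derivable1_diffP;
      apply: ex_derive; exact: dF.
  rewrite (@continuous_FTC2 _ _ (fun t => a^-1 * t `^ a))//.
  - by rewrite powR1 mulr1 EFinB.
  - apply: continuous_in_subspaceT => x; rewrite inE/= in_itv/= => /andP[nx _].
    by apply: powR_continuous_gt0; rewrite (lt_le_trans n0).
  - split.
    + move=> x; rewrite in_itv/= => /andP[nx _]; apply: ex_derive.
      by apply: dF; rewrite (lt_trans n0).
    + by apply: cvg_at_right_filter; exact: cF.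
    + by apply: cvg_at_left_filter; exact: cF.
  - move=> x; rewrite in_itv/= => /andP[nx _]; rewrite derive1E.
    by apply: derive_val; apply: dF; rewrite (lt_trans n0).
change ((fun n => \int[@lebesgue_measure R]_(t in F n) (t `^ (a - 1))%:E)%E
  @ \oo --> (a^-1)%:E); rewrite (funext FE).
apply: cvg_EFin; first exact: nearW.
rewrite -[X in _ --> X]subr0; apply: cvgB; first exact: cvg_cst.
rewrite -[X in _ --> X](mulr0 a^-1); apply: cvgMr.
have /cvg_at_rightP := powR_cvg0 a0.
apply; split=> [n|]; first by rewrite invr_gt0.
exact: cvg_harmonic.
Qed.

(** * Averages against the density [a t^(a-1)] on []0, 1]] *)

Section powR_average.
Context {R : realType}.
Local Notation leb := (@lebesgue_measure R).
Local Notation weighted a h := (fun t : R => (t `^ (a - 1) * h t)%:E).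
Implicit Types (a c e l r t M : R) (f g h k : R -> R).

Lemma measurable_weighted a h : measurable_fun (`]0, 1] : set R) h ->
  measurable_fun (`]0, 1] : set R) (weighted a h).
Proof.
move=> mh; apply/measurable_EFinP; apply: measurable_funM => //.
exact: measurable_funTS (measurable_powR _).
Qed.

(** The density has total mass 1. This allows a constant to be replaced by its own average, so that
    only averages have to be compared. *)
Lemma integral_weighted_cst a c : 0 < a -> 0 <= c ->
  (a%:E * \int[leb]_(t in `]0%R, 1%R]) weighted a (cst c) t = c%:E)%E.
Proof.
move=> a0 c0.
under eq_integral do rewrite /= mulrC EFinM.
rewrite ge0_integralZl//; last 2 first.
- by apply/measurable_EFinP; exact: measurable_funTS (measurable_powR _).
- by move=> x _; rewrite lee_fin powR_ge0.
by rewrite integral_powR_oc01// -!EFinM mulrCA mulfV ?gt_eqF// mulr1.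
Qed.

(** Substitute for linearity: with nonnegative functions and sums only, no integrability has to be
    checked and no extended reals are subtracted. *)
Lemma le_integral_weightedD a h g k : 0 < a ->
  measurable_fun (`]0, 1] : set R) h ->
  measurable_fun (`]0, 1] : set R) g ->
  measurable_fun (`]0, 1] : set R) k ->
  (forall t, 0 < t <= 1 -> 0 <= h t) ->
  (forall t, 0 < t <= 1 -> 0 <= g t) ->
  (forall t, 0 < t <= 1 -> 0 <= k t) ->
  (forall t, 0 < t <= 1 -> h t <= g t + k t) ->
  (a%:E * \int[leb]_(t in `]0%R, 1%R]) weighted a h t <=
   a%:E * \int[leb]_(t in `]0%R, 1%R]) weighted a g t +
   a%:E * \int[leb]_(t in `]0%R, 1%R]) weighted a k t)%E.
Proof.
move=> a0 mh mg mk h0 g0 k0 hgk.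
have w0 f : (forall t, 0 < t <= 1 -> 0 <= f t) ->
    forall t, `]0, 1]%classic t -> (0 <= weighted a f t)%E.
  by move=> f0 t; rewrite /= in_itv/= => /f0 ft0; rewrite lee_fin mulr_ge0 ?powR_ge0.
rewrite -ge0_muleDr; [|exact/integral_ge0/w0..].
rewrite lee_pmul2l// -ge0_integralD//=;
  [|exact: w0|exact: measurable_weighted|exact: w0|exact: measurable_weighted].
apply: ge0_le_integral => //; first exact: w0.
- exact: measurable_weighted.
- by apply: emeasurable_funD; exact: measurable_weighted.
- move=> t; rewrite /= in_itv/= => t01.
  by rewrite -EFinD lee_fin -mulrDr ler_wpM2l ?powR_ge0 ?hgk.
Qed.

(** Write [t^(a-1)] as [t^a / t], with [t^a <= 1] and [1/t <= 1/r]. The bound does not depend on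
    [a]. *)
Lemma powR_subr1_le a r t : 0 < a -> 0 < r -> r <= t <= 1 -> t `^ (a - 1) <= r^-1.
Proof.
move=> a0 r0 /andP[rt t1]; have t0 : 0 < t by rewrite (lt_le_trans r0).
rewrite powRB ?(gt_eqF t0) ?implybT// powRr1 ?(ltW t0)//.
apply: (@le_trans _ _ t^-1); last by rewrite lef_pV2.
rewrite ler_piMl ?invr_ge0 ?(ltW t0)//.
rewrite (_ : 1 = 1 `^ a); last by rewrite powR1.
by rewrite ge0_ler_powR ?nnegrE ?(ltW a0) ?(ltW t0).
Qed.

(** Below [r] the function is at most [e] and the density has mass at most 1; above [r] the function
    is at most [M] and the density at most [a / r]. *)
Lemma le_integral_weighted a r e M h : 0 < a -> 0 < r -> 0 <= e -> 0 <= M ->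
  measurable_fun (`]0, 1] : set R) h ->
  (forall t, 0 < t <= 1 -> 0 <= h t <= M) ->
  (forall t, 0 < t < r -> h t <= e) ->
  (a%:E * \int[leb]_(t in `]0%R, 1%R]) weighted a h t <= (e + a * (M / r))%:E)%E.
Proof.
move=> a0 r0 e0 M0 mh h0M hr.
(* The weight times [f] is the constant [M / r]. *)
pose f t := t `^ (1 - a) * (M / r).
have mf : measurable_fun (`]0, 1] : set R) f.
  by apply: measurable_funM => //; exact: measurable_funTS (measurable_powR _).
apply: (@le_trans _ _ (a%:E * \int[leb]_(t in `]0%R, 1%R]) weighted a (cst e) t +
    a%:E * \int[leb]_(t in `]0%R, 1%R]) weighted a f t)%E).
  apply: le_integral_weightedD => //.
  - by move=> t /h0M /andP[].
  - by move=> t _; rewrite /f mulr_ge0 ?powR_ge0 ?divr_ge0 ?(ltW r0).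
  - move=> t /andP[t0 t1]; have [tr|rt] := ltP t r.
      rewrite (le_trans (hr t _)) ?t0//.
      by rewrite lerDl /f mulr_ge0 ?powR_ge0 ?divr_ge0 ?(ltW r0).
    (* For [t >= r], [f t] is [M] times [r^-1 / t^(a-1)], a quotient which is at least 1 by
       [powR_subr1_le]; hence [f] dominates [M] there. *)
    have /andP[_ hM] : 0 <= h t <= M by rewrite h0M// t0.
    rewrite (le_trans hM)// (@le_trans _ _ (f t))//= ?lerDr//.
    have -> : f t = M * (r^-1 / t `^ (a - 1)).
      by rewrite /f -powRN opprB mulrC mulrA.
    rewrite ler_peMr// ler_pdivlMr ?powR_gt0// mul1r.
    by apply: powR_subr1_le; rewrite ?rt.
rewrite (integral_weighted_cst _ _ a0 e0) EFinD leeD2l// EFinM.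
rewrite (_ : (\int[leb]_(t in _) _)%E = (M / r)%:E)//.
rewrite -[RHS]mule1 -(_ : leb `]0, 1]%classic = 1%E); last first.
  by rewrite lebesgue_measure_itv/= lte_fin ltr01 oppr0 adde0.
rewrite -integral_cst//; apply: eq_integral => t; rewrite inE/= in_itv/= => /andP[t0 _].
rewrite /f mulrA -powRD; first by rewrite addrA subrK subrr powRr0 mul1r.
by rewrite (gt_eqF t0) implybT.
Qed.

(** The average of [|h - l|] tends to 0 by [le_integral_weighted]; the inequalities
    [h <= l + |h - l|] and [l <= h + |h - l|] are then averaged. *)
Lemma cvg_powR_average h l M : measurable_fun (`]0, 1] : set R) h ->
  (forall t, 0 < t <= 1 -> 0 <= h t <= M) ->
  h t @[t --> 0^'+] --> l ->
  (a%:E * \int[leb]_(t in `]0%R, 1%R]) weighted a h t)%E @[a --> 0^'+] --> l%:E.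
Proof.
move=> mh h0M hl.
have h0 t : 0 < t <= 1 -> 0 <= h t by move=> /h0M /andP[].
have hM t : 0 < t <= 1 -> h t <= M by move=> /h0M /andP[].
have M0 : 0 <= M by rewrite (le_trans (h0 1 _) (hM 1 _))// ltr01 lexx.
have l0 : 0 <= l.
  rewrite -(cvg_lim _ hl)//; apply: limr_ge; first exact: cvgP hl.
  near=> t; apply: h0; apply/andP; split.
    by near: t; exact: nbhs_right_gt.
  by near: t; exact: nbhs_right_le.
pose g t := `|h t - l|.
have mg : measurable_fun (`]0, 1] : set R) g.
  by apply: measurableT_comp => //; exact: measurable_funB.
pose I a f := (a%:E * \int[leb]_(t in `]0%R, 1%R]) weighted a f t)%E.
have close e : 0 < e -> \forall a \near 0^'+,
    (I a h <= (l + e)%:E)%E /\ (l%:E <= I a h + e%:E)%E.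
  move=> e0.
  (* One half of [e] bounds [g] near 0, the other half bounds the term [a * ((M + l) / r)]. *)
  have e20 : 0 < e / 2 by rewrite divr_gt0.
  move/cvgrPdist_le : hl => /(_ _ e20)[r /= r0 hr].
  have gr t : 0 < t < r -> g t <= e / 2.
    move=> /andP[t0 tr]; rewrite /g distrC; apply: hr => //=.
    by rewrite sub0r normrN gtr0_norm.
  have g0M t : 0 < t <= 1 -> 0 <= g t <= M + l.
    move=> t01; rewrite normr_ge0/= (le_trans (ler_normB _ _))//.
    by rewrite !ger0_norm ?h0// lerD2r hM.
  have Ml0 : 0 <= M + l by rewrite addr_ge0.
  (* Adding 1 keeps the constant positive even when [M + l = 0], so that [e / 2] can be divided by
     it. *)
  have K0 : 0 < (M + l) / r + 1 by rewrite ltr_wpDl// divr_ge0// ltW.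
  near=> a.
  have a0 : 0 < a by near: a; exact: nbhs_right_gt.
  have Ige : (I a g <= e%:E)%E.
    apply: (le_trans (le_integral_weighted _ _ _ _ _ a0 r0 (ltW e20) Ml0 mg g0M gr)).
    rewrite lee_fin [leRHS]splitr lerD2l.
    apply: (@le_trans _ _ (a * ((M + l) / r + 1))).
      by rewrite ler_wpM2l ?(ltW a0)// lerDl.
    by rewrite -ler_pdivlMr//; near: a; apply: nbhs_right_le; rewrite divr_gt0.
  split.
  - rewrite EFinD -(integral_weighted_cst _ _ a0 l0).
    apply: le_trans (leeD2l _ Ige).
    apply: le_integral_weightedD => //; first by move=> t /g0M /andP[].
    by move=> t _; rewrite -lerBlDl ler_norm.
  - rewrite -{1}(integral_weighted_cst _ _ a0 l0).
    apply: le_trans (leeD2l _ Ige).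
    apply: le_integral_weightedD => //; first by move=> t /g0M /andP[].
    by move=> t _; rewrite -lerBlDl /g distrC ler_norm.
apply/fine_cvgP; split.
(* The two bounds with [e = 1] exclude the values [+oo] and [-oo] for [a] near 0. *)
- have := close 1 ltr01; apply: filterS => a; rewrite -/(I a h) => -[].
  by case: (I a h).
- apply/cvgrPdist_le => e /close; apply: filterS => a; rewrite /= -/(I a h) => -[].
  case: (I a h) => // x; rewrite -EFinD !lee_fin => xle lxe.
  by rewrite ler_distl lerBlDr xle lxe.
Unshelve. all: by end_near. Qed.

End powR_average.

(** Serves the substitution [a = alpha * (p / 2)] in a right-hand limit; [c > 0] keeps the argument
    on the right of 0. *)
Lemma cvg_mul_at_right0 {R : realType} (c : R) : 0 < c ->
  x * c @[x --> (0 : R)^'+] --> (0 : R)^'+.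
Proof.
move=> c0 P [e /= e0 eP]; exists (e / c) => /=; first by rewrite divr_gt0.
move=> x /=; rewrite sub0r normrN => xe x0; apply: eP => /=.
  by rewrite sub0r normrN normrM (gtr0_norm c0) -ltr_pdivlMr.
by rewrite mulr_gt0.
Qed.

(** * Measurability in time of the norms *)

Section Lpnorm_family.
Context {R : realType} {d : measure_display} {E : measurableType d}.
Variables (mu : {sigma_finite_measure set E -> \bar R}) (p : R).
Variable p1 : (1 <= p%:E)%E.
Implicit Type f : LspaceType mu p1.

Let p_gt0 : 0 < p.
Proof. by rewrite (lt_le_trans ltr01)// -lee_fin. Qed.

Lemma Lpnorm_fin_num f : Lpnorm f \is a fin_num.
Proof.
by rewrite ge0_fin_numE; [exact: Lebesgue_finite|exact: Lnorm_ge0].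
Qed.

(** By Tonelli, the integral over [E] of [|u (t, x)|^p] is measurable in [t]; for each [t > 0] it
    equals the p-th power of the norm, since [u (t, _)] represents [S t f]. *)
Lemma measurable_Lpnorm_powR (S : R -> LspaceType mu p1 -> LspaceType mu p1) f :
  jointly_measurable_family S ->
  measurable_fun (`]0, +oo[ : set R) (fun t => (Lpnorm (S t f) `^ p)%E).
Proof.
move=> /(_ f)[u [mu_ uS]].
pose D := (`]0%R, +oo[ : set (measurableTypeR R)) `*` [set: E].
have mD : measurable D by apply: measurableX.
(* [u] is measurable on [D] only; its extension by zero is measurable everywhere, as Tonelli
   requires, and has the same slices for [t > 0]. *)
pose v := u \_ D.
have mv : measurable_fun setT v by apply/(measurable_restrictT _ mD).
pose w z := ((`|v z| `^ p)%:E : \bar R).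
have mw : measurable_fun setT w.
  apply/measurable_EFinP.
  apply: (@measurableT_comp _ _ _ _ _ _ (@powR R ^~ p)).
    exact: measurable_powR.
  exact: measurableT_comp.
have w0 z : (0 <= w z)%E by rewrite lee_fin powR_ge0.
have mF := measurable_fun_fubini_tonelli_F (m2 := mu) w mw w0.
apply: (eq_measurable_fun (fubini_F mu w)); last exact: measurable_funTS mF.
move=> t; rewrite inE/= in_itv/= andbT => t0.
rewrite /Lpnorm poweR_Lnorm ?gt_eqF// /fubini_F.
have Dt x : D (t, x) by split => //=; rewrite in_itv/= t0.
apply: ge0_ae_eq_integral => //.
- exact: measurable_fun_pair2 mw.
- apply: (measurableT_comp (measurable_poweR _)).
  apply: measurableT_comp => //; apply/measurable_EFinP.
  exact: (@measurable_funP _ _ _ (measurableTypeR R) setT (repr (S t f : aeEqMfun _ _))).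
- by move=> x _; exact: poweR_ge0.
- move: (uS t t0); apply: filterS => x /= uSx _.
  by rewrite /w /v patchE mem_set// uSx.
Qed.

End Lpnorm_family.

(** * Reduction of the Sobolev norm to an average *)

Theorem theorem3p2 (R : realType) (d : measure_display) (E : measurableType d)
    (mu : {sigma_finite_measure set E -> \bar R})
    (p : R) (p1 : (1 <= p%:E)%E)
    (S : R -> LspaceType mu p1 -> LspaceType mu p1)
    (S_measurable : jointly_measurable_family S)
    (S_bounded : exists2 C : R, 0 < C &
       forall t : R, 0 < t <= 1 -> forall f : LspaceType mu p1,
         (Lpnorm (S t f) <= C%:E * Lpnorm f)%E)
    (S_continuous : forall f : LspaceType mu p1,
       Lpnorm (S t f) @[t --> (0 : R)^'+] --> Lpnorm f)
    (f : LspaceType mu p1) :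
  (alpha%:E * neg_sobolev_norm S alpha f `^ p)%E @[alpha --> (0 : R)^'+]
    --> ((2 / p)%:E * Lpnorm f `^ p)%E.
Proof.
have p0 : 0 < p by rewrite (lt_le_trans ltr01)// -lee_fin.
pose n t := fine (Lpnorm (S t f)).
pose N := fine (Lpnorm f).
have nE t : Lpnorm (S t f) = (n t)%:E by rewrite fineK// Lpnorm_fin_num.
have NE : Lpnorm f = N%:E by rewrite fineK// Lpnorm_fin_num.
have n0 t : 0 <= n t by rewrite fine_ge0// Lnorm_ge0.
have N0 : 0 <= N by rewrite fine_ge0// Lnorm_ge0.
have [C C0 nC] : exists2 C, 0 < C & forall t, 0 < t <= 1 -> n t <= C * N.
  case: S_bounded => C C0 SC; exists C => // t /SC/(_ f).
  by rewrite nE NE -EFinM lee_fin.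
have cvgn : n t @[t --> 0^'+] --> N.
  by have := S_continuous f; rewrite NE => /fine_cvgP[].
have cvgnp : n t `^ p @[t --> 0^'+] --> N `^ p.
  (* Continuity of the power is available only at positive points. If [N = 0], the bound
     [n t <= C * N] makes [n] vanish on []0, 1]]. *)
  have [N00|NN0] := eqVneq N 0.
    apply: cvg_near_cst; near=> t.
    have /eqP -> : n t == N; last by [].
    rewrite N00 eq_le n0 andbT -(mulr0 C) -N00 nC//.
    apply/andP; split; first by near: t; exact: nbhs_right_gt.
    by near: t; exact: nbhs_right_le.
  have N_gt0 : 0 < N by rewrite lt_neqAle eq_sym NN0.
  exact: (cvg_comp _ _ cvgn (powR_continuous_gt0 p N N_gt0)).
have mnp : measurable_fun (`]0, 1] : set R) (fun t => n t `^ p).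
  apply/measurable_EFinP.
  apply: (eq_measurable_fun (fun t => (Lpnorm (S t f) `^ p)%E)).
    by move=> t _ /=; rewrite nE.
  apply: measurable_funS (measurable_Lpnorm_powR _ _ _ _ _ S_measurable) => //.
  by move=> t /=; rewrite !in_itv/= => /andP[-> _].
(* The outer power cancels the root in the norm, and the exponent is regrouped as [alpha * (p / 2)]
   to match the substitution. *)
have normE alpha : (neg_sobolev_norm S alpha f `^ p =
    \int[@lebesgue_measure R]_(t in `]0%R, 1%R])
      (t `^ (alpha * (p / 2) - 1) * n t `^ p)%:E)%E.
  rewrite /neg_sobolev_norm -poweRrM mulVf ?gt_eqF// poweRe1; last first.
    by apply: integral_ge0 => t _; rewrite mule_ge0 ?lee_fin ?powR_ge0 ?poweR_ge0.
  by apply: eq_integral => t _; rewrite nE poweR_EFin EFinM mulrA.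
have np_bounded t : 0 < t <= 1 -> 0 <= n t `^ p <= (C * N) `^ p.
  move=> t01; rewrite powR_ge0/= ge0_ler_powR ?nnegrE ?n0 ?nC ?(ltW p0)//.
  by rewrite mulr_ge0// ltW.
have := cvg_powR_average _ _ _ mnp np_bounded cvgnp.
have p20 : 0 < p / 2 by rewrite divr_gt0.
(* The average carries the factor [alpha * (p / 2)]; scaling by [2 / p] turns it into [alpha] and
   produces the constant of the limit. *)
move=> /(cvg_comp _ _ (cvg_mul_at_right0 _ p20)) /(cvgeZl (isT : (2 / p)%:E \is a fin_num)).
rewrite NE poweR_EFin; apply: cvg_trans; apply: near_eq_cvg; near=> alpha.
rewrite /= normE muleA -EFinM; congr (_%:E * _)%E.
by rewrite mulrCA -(invf_div p 2) mulVf ?gt_eqF// mulr1.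
Unshelve. all: by end_near. Qed.
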